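(* Let $n\geqslant 4$ and let $\langle a_0,b_0,e_0,c_0\mid S\rangle$ be a presentation of the monoid $\mathscr{PT}^0_{n-1}$ on the generators $a_0$, $b_0$, $e_0$ and $c_0$. Then $$ \langle a_0,b_0,e_0,c_0,z \mid S,\ a_0z = b_0z = e_0z = z,\ z^2=(e_0b_0)^{n-3}e_0,\ z^2c_0=zc_0 \rangle $$ is a presentation of $\mathrm{wEnd}\,S_n$ on the generators $a_0$, $b_0$, $e_0$, $c_0$ and $z$.
   Context: For an integer $n\geqslant 1$, let $\Omega_{n-1}^0=\{0,1,\ldots,n-1\}$ and let $S_n$ be the star graph with vertex set $\Omega_{n-1}^0$ and edge set $E=\{\{0,i\}\mid 1\leqslant i\leqslant n-1\}$. (The set of relations $S$ is unrelated to the graph $S_n$.) Maps are written on the right of their arguments and composed from left to right (so $x(\alpha\beta)=(x\alpha)\beta$). $\mathrm{wEnd}\,S_n$ is the monoid under composition of all weak endomorphisms of $S_n$, i.e. of all maps $\alpha:\Omega_{n-1}^0\to\Omega_{n-1}^0$ such that, for all vertices $u,v$, $\{u,v\}\in E$ and $u\alpha\neq v\alpha$ imply $\{u\alpha,v\alpha\}\in E$. $\mathscr{PT}^0_{n-1}$ is the monoid of all full transformations $\alpha$ of $\Omega_{n-1}^0$ such that $0\alpha=0$. It is generated by $a_0,b_0,e_0,c_0$. The following are full transformations of $\Omega_{n-1}^0$: - $a_0$: $0\mapsto 0$, $1\mapsto 2$, $2\mapsto 1$, and $i\mapsto i$ for $3\leqslant i\leqslant n-1$; - $b_0$: $0\mapsto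 0$, $i\mapsto i+1$ for $1\leqslant i\leqslant n-2$, and $n-1\mapsto 1$; - $e_0$: $0\mapsto 0$, $1\mapsto 1$, $2\mapsto 1$, and $i\mapsto i$ for $3\leqslant i\leqslant n-1$; - $c_0$: $0\mapsto 0$, $1\mapsto 0$, and $i\mapsto i$ for $2\leqslant i\leqslant n-1$; - $z$: $0\mapsto 1$ and $i\mapsto 0$ for $1\leqslant i\leqslant n-1$. Presentations: for an alphabet $X$, $X^*$ is the free monoid on $X$; a monoid presentation is a pair $\langle X\mid R\rangle$ with $R\subseteq X^*\times X^*$, and a pair $(u,v)\in R$ is written as a relation $u=v$ (a chain $u_1=u_2=\cdots=u_k$ abbreviates the corresponding relations between its terms). Let $\sim_R$ be the congruence on $X^*$ generated by $R$. If $X$ is a subset of a monoid $M$ generating $M$, then $\langle X\mid R\rangle$ is a presentation of $M$ on the generators $X$ if, for all $w_1,w_2\in X^*$, $w_1\sim_R w_2$ if and only if $w_1$ and $w_2$ represent the same element of $M$ (equivalently, the canonical homomorphism $X^*\to M$ induces an isomorphism $X^*/{\sim_R}\cong M$). The same symbols are used for the letters and for the elements of $M$ they represent. *)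

(* Defs.v *)
From HB Require Import structures.
From mathcomp Require Import all_boot.

Set Implicit Arguments.
Unset Strict Implicit.
Unset Printing Implicit Defensive.

Local Open Scope group_scope.

(* Words over X, i.e. elements of the free monoid X^*, are [seq X] with
   concatenation [++]; a set of relations is a binary predicate on words. *)
Definition relations (X : Type) := seq X -> seq X -> Prop.

Inductive congruence_gen (X : Type) (R : relations X) : relations X :=
| cg_rel u v of R u v : congruence_gen R u v
| cg_refl u : congruence_gen R u u
| cg_sym u v of congruence_gen R u v : congruence_gen R v u
| cg_trans u v w of congruence_gen R u v & congruence_gen R v w :
    congruence_gen R u w
| cg_cat u1 v1 u2 v2 of congruence_gen R u1 v1 & congruence_gen R u2 v2 :
    congruence_gen R (u1 ++ u2) (v1 ++ v2).

Section Presentation.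
Variables (X : Type) (M : monoidType) (g : X -> M).

Definition word_val (w : seq X) : M := \prod_(x <- w) g x.

(* The alphabet X is regarded as a subset of M through the injection g. *)
Definition is_presentation (R : relations X) : Prop :=
  [/\ injective g,
      forall m : M, exists w, word_val w = m
    & forall w1 w2, congruence_gen R w1 w2 <-> word_val w1 = word_val w2].

End Presentation.

(* Full transformations, acting on the right: [a * b] is first a, then b. *)
Definition transf (V : finType) := {ffun V -> V}.
Identity Coercion transf_finfun : transf >-> finfun_of.

Section Transformations.
Variable V : finType.
HB.instance Definition _ := Choice.on (transf V).

Definition transf_one : transf V := [ffun x => x].
Definition transf_mul (a b : transf V) : transf V := [ffun x => b (a x)].

Fact transf_mulA : associative transf_mul.
Proof. by move=> a b c; apply/ffunP => x; rewrite !ffunE. Qed.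
Fact transf_mul1 : left_id transf_one transf_mul.
Proof. by move=> a; apply/ffunP => x; rewrite !ffunE. Qed.
Fact transf_mulr1 : right_id transf_one transf_mul.
Proof. by move=> a; apply/ffunP => x; rewrite !ffunE. Qed.

HB.instance Definition _ :=
  isMonoid.Build (transf V) transf_mulA transf_mul1 transf_mulr1.

Lemma transf1E x : (1 : transf V) x = x.
Proof. by rewrite ffunE. Qed.
Lemma transfME (a b : transf V) x : (a * b) x = b (a x).
Proof. by rewrite ffunE. Qed.

End Transformations.

Section WeakEndomorphisms.
Variables (V : finType) (E : {set {set V}}).

Definition weak_endo : {pred transf V} :=
  [pred a : transf V | [forall u : V, forall v : V,
     ([set u; v] \in E) && (a u != a v) ==> ([set a u; a v] \in E)]].

Lemma weak_endoP (a : transf V) :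
  reflect (forall u v, [set u; v] \in E -> a u != a v -> [set a u; a v] \in E)
          (a \in weak_endo).
Proof.
apply: (iffP idP) => [|aE]; rewrite inE.
  move=> /forallP aE u v uvE auv.
  by move/forallP: (aE u) => /(_ v); rewrite uvE auv.
by apply/forallP => u; apply/forallP => v; apply/implyP => /andP[]; apply: aE.
Qed.

Fact weak_endo_monoid_closed : umagma_closed weak_endo.
Proof.
split=> [|a b /weak_endoP aE /weak_endoP bE]; apply/weak_endoP => u v.
  by rewrite !transf1E.
rewrite !transfME => uvE abuv; apply: (bE _ _ _ abuv); apply: aE => //.
by apply: contraNneq abuv => ->.
Qed.

Record wEnd := WEnd {wEnd_val :> transf V; _ : wEnd_val \in weak_endo}.
HB.instance Definition _ := [isSub for wEnd_val].
HB.instance Definition _ := [Choice of wEnd by <:].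
HB.instance Definition _ :=
  SubChoice_isSubMonoid.Build _ _ wEnd weak_endo_monoid_closed.

End WeakEndomorphisms.

Local Close Scope group_scope.

(* The set {0, 1, ..., k}. *)
Notation Omega0 k := 'I_k.+1.

(* The star graph S_n on {0, ..., n-1}, for n >= 1. *)
Definition star_edges (n : nat) : {set {set Omega0 n.-1}} :=
  [set [set ord0; i] | i : Omega0 n.-1 & i != ord0].

Definition fix0 (k : nat) : {pred transf (Omega0 k)} :=
  [pred a : transf (Omega0 k) | a ord0 == ord0].
Arguments fix0 : clear implicits.

Section PT0.
Variable k : nat.

Fact fix0_monoid_closed : umagma_closed (fix0 k).
Proof.
split=> [|a b]; rewrite !inE ?transf1E // transfME.
by move=> /eqP -> /eqP ->.
Qed.

(* The monoid PT^0_k. *)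
Record PT0 := MkPT0 {PT0_val :> transf (Omega0 k); _ : PT0_val \in fix0 k}.
HB.instance Definition _ := [isSub for PT0_val].
HB.instance Definition _ := [Choice of PT0 by <:].
HB.instance Definition _ :=
  SubChoice_isSubMonoid.Build _ _ PT0 fix0_monoid_closed.

(* The transformation given by f : nat -> nat; [inord] is only meaningful
   when f maps {0, ..., k} into itself, which for the maps below is the case
   as soon as k >= 2. *)
Definition transf_nat (f : nat -> nat) : transf (Omega0 k) :=
  [ffun x : Omega0 k => inord (f x)].

Definition ta0 := transf_nat (fun i : nat =>
  if i == 1 then 2 else if i == 2 then 1 else i).
Definition tb0 := transf_nat (fun i : nat =>
  if i == 0 then 0 else if i == k then 1 else i.+1).
Definition te0 := transf_nat (fun i : nat => if i == 2 then 1 else i).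
Definition tc0 := transf_nat (fun i : nat => if i == 1 then 0 else i).
Definition tz := transf_nat (fun i : nat => if i == 0 then 1 else 0).

End PT0.

Inductive PT0_letter := La | Lb | Le | Lc.

Definition PT0_transf (k : nat) (x : PT0_letter) : transf (Omega0 k) :=
  match x with La => ta0 k | Lb => tb0 k | Le => te0 k | Lc => tc0 k end.

Fact PT0_transf_fix0 k x : PT0_transf k x \in fix0 k.
Proof.
by rewrite inE; case: x; rewrite ffunE; apply/eqP/val_inj; rewrite /= inordK.
Qed.

Definition PT0_gen (k : nat) (x : PT0_letter) : PT0 k :=
  MkPT0 (PT0_transf_fix0 k x).

Inductive wEnd_letter := Lold of PT0_letter | Lz.

Definition wEnd_transf (n : nat) (x : wEnd_letter) : transf (Omega0 n.-1) :=
  match x with Lold y => PT0_transf n.-1 y | Lz => tz n.-1 end.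

Lemma star_edgesP n (u v : Omega0 n.-1) :
  ([set u; v] \in star_edges n) = (u == ord0) (+) (v == ord0).
Proof.
apply/imsetP/idP => [[i]|].
  rewrite inE => i0 uv.
  have: u \in [set ord0; i] by rewrite -uv set21.
  have: v \in [set ord0; i] by rewrite -uv set22.
  have: i \in [set u; v] by rewrite uv set22.
  have: ord0 \in [set u; v] by rewrite uv set21.
  rewrite !inE => h0 hi /orP[]/eqP ev /orP[]/eqP eu; move: h0 hi i0.
  - by rewrite eu ev !orbb => _ ->.
  - by rewrite eu ev eqxx => _ _ /negPf ->.
  - by rewrite eu ev eqxx => _ _ /negPf ->.
  - by rewrite eu ev !orbb eq_sym => ->.
have [->|u0] := eqVneq u ord0; have [->|v0] //= := eqVneq v ord0 => _.
  by exists v; rewrite ?inE.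
by exists u; rewrite ?inE // setUC.
Qed.

Fact wEnd_transf_weak_endo n x : wEnd_transf n x \in weak_endo (star_edges n).
Proof.
apply/weak_endoP => u v; rewrite !star_edgesP.
case: x => [y|] /=.
  have:= PT0_transf_fix0 n.-1 y; rewrite inE => /eqP y0.
  have [->|u0] := eqVneq u ord0; have [->|v0] //= := eqVneq v ord0 => _;
    rewrite y0 eqxx.
  - by rewrite eq_sym => /negPf ->.
  - by move=> /negPf ->.
have z0 (i : Omega0 n.-1) : i != ord0 -> tz n.-1 i = ord0.
  move=> i0; rewrite ffunE; apply: val_inj; rewrite /= inordK.
    by move: i0; rewrite -val_eqE /= => /negPf ->.
  by case: ifP => // /eqP i0'; rewrite -val_eqE /= i0' in i0.
have [->|u0] := eqVneq u ord0; have [->|v0] //= := eqVneq v ord0 => _.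
- by rewrite (z0 _ v0) eqxx => /negPf ->.
- by rewrite (z0 _ u0) eqxx eq_sym => /negPf ->.
Qed.

Definition wEnd_gen (n : nat) (x : wEnd_letter) : wEnd (star_edges n) :=
  WEnd (wEnd_transf_weak_endo n x).

Definition word_pow (X : Type) (w : seq X) (m : nat) : seq X :=
  flatten (nseq m w).

Local Notation a := (Lold La).
Local Notation b := (Lold Lb).
Local Notation e := (Lold Le).
Local Notation c := (Lold Lc).
Local Notation z := Lz.

Inductive wEnd_rel (n : nat) (S : relations PT0_letter) :
    relations wEnd_letter :=
| rel_S u v of S u v : wEnd_rel n S (map Lold u) (map Lold v)
| rel_ab : wEnd_rel n S [:: a; z] [:: b; z]
| rel_be : wEnd_rel n S [:: b; z] [:: e; z]
| rel_ez : wEnd_rel n S [:: e; z] [:: z]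
| rel_zz : wEnd_rel n S [:: z; z] (word_pow [:: e; b] (n - 3) ++ [:: e])
| rel_zzc : wEnd_rel n S [:: z; z; c] [:: z; c].

(* Main.v *)
(** Call "old" the words over a, b, e, c and their values. An old t mapping no
    nonzero vertex to 0 satisfies t z ~ z: each letter c in t acts trivially, so
    it can be deleted, and a z ~ b z ~ e z ~ z; let A be the set of these t.
    For old u and v:
    - u z depends, modulo the relations, only on the set of vertices sent to 0
      by u, since u = h t with t in A and h a partial identity;
    - z v depends only on the image of 1 under v, since z ~ z^3 and z^2 is the
      old element collapsing all nonzero vertices to 1; if 1 v = 0, then
      z v ~ z c ~ z^2 c is old;
    - z v z ~ z^2 if 1 v <> 0, since then z^2 v lies in A.
    Hence every word is equivalent to an old one or to u z v with 1 v <> 0.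
    The latter maps 0 to 1 v <> 0, and its value determines 1 v and the set of
    vertices sent to 0 by u. *)
Require Import Defs.
From mathcomp Require Import all_boot.
From mathcomp Require Import zify.

Set Implicit Arguments.
Unset Strict Implicit.
Unset Printing Implicit Defensive.

(** * Words and generated congruences *)

Lemma word_val_cons (X : Type) (M : monoidType) (g : X -> M) x w :
  word_val g (x :: w) = (g x * word_val g w)%g.
Proof. by rewrite /word_val big_cons. Qed.

Lemma word_val_cat (X : Type) (M : monoidType) (g : X -> M) u v :
  word_val g (u ++ v) = (word_val g u * word_val g v)%g.
Proof. by rewrite /word_val big_cat. Qed.

Lemma congruence_gen_sound (X : Type) (M : monoidType) (g : X -> M)
    (R : relations X) :
  (forall u v, R u v -> word_val g u = word_val g v) ->
  forall u v, congruence_gen R u v -> word_val g u = word_val g v.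
Proof.
move=> gR u v; elim=> {u v} [u v /gR //| // | // |u v w _ -> //|].
by move=> u1 v1 u2 v2 _ e1 _ e2; rewrite !word_val_cat e1 e2.
Qed.

Lemma cg_catl (X : Type) (R : relations X) w u v :
  congruence_gen R u v -> congruence_gen R (w ++ u) (w ++ v).
Proof. by apply: cg_cat; apply: cg_refl. Qed.

Lemma cg_catr (X : Type) (R : relations X) w u v :
  congruence_gen R u v -> congruence_gen R (u ++ w) (v ++ w).
Proof. by move=> uv; apply: cg_cat uv _; apply: cg_refl. Qed.

(** * Values of words as transformations *)

Definition act (k : nat) : seq PT0_letter -> transf (Omega0 k) :=
  word_val (PT0_transf k).

(** Here n = k + 1, so the vertex set of S_n is [Omega0 k] by computation and both evaluations land
    in the same monoid. *)
Definition wact (k : nat) : seq wEnd_letter -> transf (Omega0 k) :=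
  word_val (wEnd_transf k.+1).

Definition vertex1 (k : nat) : Omega0 k := inord 1.

(** The right-hand side of the relation for z^2 as an old word, with n - 3 = k - 2. *)
Definition const1 (k : nat) : seq PT0_letter :=
  word_pow [:: Le; Lb] (k - 2) ++ [:: Le].

Definition drop_c : seq PT0_letter -> seq PT0_letter :=
  filter (fun x => if x is Lc then false else true).

Lemma PT0_val_word_val k w : PT0_val (word_val (PT0_gen k) w) = act k w.
Proof.
elim: w => [|x w IHw]; first by rewrite /act /word_val !big_nil.
by rewrite /act !word_val_cons -[word_val (PT0_transf k) w]IHw.
Qed.

Lemma wEnd_val_word_val k w : wEnd_val (word_val (wEnd_gen k.+1) w) = wact k w.
Proof.
elim: w => [|x w IHw]; first by rewrite /wact /word_val !big_nil.
by rewrite /wact !word_val_cons -[word_val (wEnd_transf k.+1) w]IHw.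
Qed.

Lemma act_cons k x w i : act k (x :: w) i = act k w (PT0_transf k x i).
Proof. by rewrite /act word_val_cons transfME. Qed.

Lemma act_cat k u v i : act k (u ++ v) i = act k v (act k u i).
Proof. by rewrite /act word_val_cat transfME. Qed.

Lemma act_nil k i : act k [::] i = i.
Proof. by rewrite /act /word_val big_nil transf1E. Qed.

Lemma PT0_transf0 k x : PT0_transf k x ord0 = ord0.
Proof. by have /[!inE]/eqP := PT0_transf_fix0 k x. Qed.

Lemma act0 k w : act k w ord0 = ord0.
Proof.
by elim: w => [|x w IHw]; rewrite ?act_nil // act_cons PT0_transf0.
Qed.

Lemma wact_cons k x w i : wact k (x :: w) i = wact k w (wEnd_transf k.+1 x i).
Proof. by rewrite /wact word_val_cons transfME. Qed.

Lemma wact_cat k u v i : wact k (u ++ v) i = wact k v (wact k u i).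
Proof. by rewrite /wact word_val_cat transfME. Qed.

Lemma wact_old k u : wact k (map Lold u) = act k u.
Proof. by rewrite /wact /act /word_val big_map. Qed.

Lemma val_ta0 k i : 1 < k ->
  ta0 k i = (if i == 1 :> nat then 2 else if i == 2 :> nat then 1 else i) :> nat.
Proof.
move=> k1; rewrite ffunE inordK //.
by have := ltn_ord i; do 2?case: ifP => _; lia.
Qed.

Lemma val_te0 k i : 0 < k -> te0 k i = (if i == 2 :> nat then 1 else i) :> nat.
Proof.
by move=> k0; rewrite ffunE inordK //; case: ifP => // _; apply: ltn_ord.
Qed.

Lemma val_tb0 k i : 0 < k ->
  tb0 k i = (if i == 0 :> nat then 0 else if i == k :> nat then 1 else i.+1) :> nat.
Proof.
move=> k0; rewrite ffunE inordK //.
by have := ltn_ord i; do 2?case: ifP => //; lia.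
Qed.

Lemma val_vertex1 k : 0 < k -> vertex1 k = 1 :> nat.
Proof. by move=> k0; rewrite inordK. Qed.

Lemma vertex1_neq0 k : 0 < k -> vertex1 k != ord0.
Proof. by move=> k0; rewrite -val_eqE /= val_vertex1. Qed.

Lemma tz0 k : tz k ord0 = vertex1 k.
Proof. by rewrite ffunE. Qed.

Lemma tzE k i : tz k i = if i == ord0 then vertex1 k else ord0.
Proof.
have [->|] := eqVneq i ord0; first exact: tz0.
rewrite ffunE -val_eqE /= => /negPf ->.
by apply: val_inj; rewrite /= inordK.
Qed.

Lemma tc0_neq0 k i : tc0 k i != ord0 -> tc0 k i = i.
Proof.
rewrite ffunE; case: ifP => _; last by rewrite inord_val.
by rewrite -val_eqE /= inordK.
Qed.

Lemma tc0_1 k : 0 < k -> tc0 k (vertex1 k) = ord0.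
Proof.
move=> k0; rewrite ffunE val_vertex1 //.
by apply: val_inj; rewrite /= inordK.
Qed.

(* [e b] fixes 2, sends 1 to 2 and shifts 3 -> 4 -> ... -> k -> 1. *)
Lemma act_eb_pow k m (i : Omega0 k) : 2 < k -> i != ord0 ->
  (i <= 2) || (k < i + m) ->
  0 < act k (word_pow [:: Le; Lb] m) i <= 2.
Proof.
move=> k2; elim: m i => [|m IHm] i.
  by rewrite -val_eqE act_nil /=; have := ltn_ord i; lia.
rewrite -val_eqE /= => i0 im.
have k0 : 0 < k by lia.
have := val_tb0 (te0 k i) k0; rewrite val_te0 //= => bi.
by rewrite !act_cons; apply: IHm; rewrite -?val_eqE /=; move: bi;
  have := ltn_ord i; repeat case: ifP => /eqP; lia.
Qed.

(** The slowest vertex is 3, which reaches 1 after exactly k - 2 rounds of e b; the last e then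
    merges 2 into 1. *)
Lemma act_const1 k i : 2 < k ->
  act k (const1 k) i = if i == ord0 then ord0 else vertex1 k.
Proof.
move=> k2; case: eqVneq => [->|i0]; first exact: act0.
rewrite act_cat act_cons act_nil /=; apply: val_inj.
rewrite /= val_te0 ?val_vertex1; try lia.
have /(_ _)/andP[|] := @act_eb_pow k (k - 2) i k2 i0; first by lia.
by case: (nat_of_ord _) => [|[|[|]]].
Qed.

(** Every old letter fixes 0, so a path from [i] that does not end at 0 never meets 0, and each c on
    it acts as the identity. *)
Lemma act_drop_c k u i :
  act k u i != ord0 -> act k (drop_c u) i = act k u i.
Proof.
elim: u i => [|x u IHu] i //=.
case: x; rewrite !act_cons //=; try by move/IHu.
move=> ui; rewrite -{1}(@tc0_neq0 k i) ?IHu //.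
by apply: contraNneq ui => ->; rewrite act0.
Qed.

(** * Derivations from the relations and normal forms *)

Section Relations.
Variables (k : nat) (S : relations PT0_letter).
Hypotheses (k2 : 2 < k) (hS : is_presentation (PT0_gen k) S).

Local Notation "u ~~~ v" := (congruence_gen (wEnd_rel k.+1 S) u v)
  (at level 70).

Let k0 : 0 < k. Proof. by lia. Qed.

(** Lets the witnesses below be prescribed as functions; this is the generation part of [hS]. *)
Lemma act_onto (t : transf (Omega0 k)) :
  t ord0 = ord0 -> exists w, act k w = t.
Proof.
move=> t0; have tP : t \in fix0 k by rewrite inE t0.
have [_ /(_ (MkPT0 tP))[w wt] _] := hS; exists w.
by rewrite -PT0_val_word_val wt.
Qed.

(** Completeness in [hS] yields a derivation from [S], which is replayed through [rel_S]. *)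
Lemma old_congr u v : act k u = act k v -> map Lold u ~~~ map Lold v.
Proof.
move=> uv; have {uv} : congruence_gen S u v.
  by have [_ _ ->] := hS; apply: val_inj; rewrite /= !PT0_val_word_val.
elim=> {u v} [u v Suv|u|u v _|u v w _ uv _|u1 v1 u2 v2 _ uv1 _ uv2].
- exact/cg_rel/rel_S.
- exact: cg_refl.
- exact: cg_sym.
- exact: cg_trans.
- by rewrite !map_cat; apply: cg_cat.
Qed.

Lemma drop_c_z u : map Lold (drop_c u) ++ [:: Lz] ~~~ [:: Lz].
Proof.
elim: u => [|x u IHu] /=; first exact: cg_refl.
have ez : [:: Lold Le; Lz] ~~~ [:: Lz] by apply/cg_rel/rel_ez.
have bz : [:: Lold Lb; Lz] ~~~ [:: Lz].
  by apply: cg_trans ez; apply/cg_rel/rel_be.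
have az : [:: Lold La; Lz] ~~~ [:: Lz].
  by apply: cg_trans bz; apply/cg_rel/rel_ab.
by case: x => //=; apply: cg_trans (cg_catl [:: _] IHu) _.
Qed.

(** [u] and [drop_c u] have the same value: [act_drop_c] covers the nonzero vertices, and both fix
    0. *)
Lemma old_z u : (forall i, i != ord0 -> act k u i != ord0) ->
  map Lold u ++ [:: Lz] ~~~ [:: Lz].
Proof.
move=> u0; apply: cg_trans (drop_c_z u); apply/cg_catr/old_congr/ffunP => i.
have [->|/u0/act_drop_c -> //] := eqVneq i ord0; by rewrite !act0.
Qed.

(* u = h t, where h is the partial identity with the kernel of u and t agrees
   with u off that kernel and sends it to 1, so that t z = z. *)
Lemma old_z_partial_id u h :
  (forall i, act k h i = if act k u i == ord0 then ord0 else i) ->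
  map Lold u ++ [:: Lz] ~~~ map Lold h ++ [:: Lz].
Proof.
move=> hE.
have [|t tE] := @act_onto [ffun i => if i == ord0 then ord0 else
    if act k u i == ord0 then vertex1 k else act k u i].
  by rewrite ffunE eqxx.
have tz : map Lold t ++ [:: Lz] ~~~ [:: Lz].
  apply: old_z => i i0; rewrite tE ffunE (negPf i0).
  by case: ifP => [_|/negbT//]; apply: vertex1_neq0.
apply: cg_trans (cg_catl (map Lold h) tz); rewrite catA -map_cat.
apply/cg_catr/old_congr/ffunP => i; rewrite act_cat hE.
case: ifP => [/eqP ->|ui]; first by rewrite act0.
rewrite tE ffunE ui; case: ifP => // /eqP i0.
by rewrite i0 act0 eqxx in ui.
Qed.

Lemma old_z_congr u v :
  (forall i, (act k u i == ord0) = (act k v i == ord0)) ->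
  map Lold u ++ [:: Lz] ~~~ map Lold v ++ [:: Lz].
Proof.
move=> uv.
have [|h hE] := @act_onto [ffun i => if act k u i == ord0 then ord0 else i].
  by rewrite ffunE if_same.
have uh : map Lold u ++ [:: Lz] ~~~ map Lold h ++ [:: Lz].
  by apply: old_z_partial_id => i; rewrite hE ffunE.
apply: cg_trans uh _; apply: cg_sym; apply: old_z_partial_id => i.
by rewrite hE ffunE uv.
Qed.

Lemma zz_const1 : [:: Lz; Lz] ~~~ map Lold (const1 k).
Proof.
have -> : map Lold (const1 k) =
    word_pow [:: Lold Le; Lold Lb] (k.+1 - 3) ++ [:: Lold Le].
  by rewrite map_cat map_flatten map_nseq.
exact/cg_rel/rel_zz.
Qed.

Lemma const1_z : map Lold (const1 k) ++ [:: Lz] ~~~ [:: Lz].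
Proof.
apply: old_z => i i0; rewrite act_const1 // (negPf i0); exact: vertex1_neq0.
Qed.

(* z = z^3, and z^2 v is the old element sending every nonzero vertex to
   the image of 1 under v. *)
Lemma z_const1_old v :
  Lz :: map Lold v ~~~ Lz :: map Lold (const1 k ++ v).
Proof.
rewrite map_cat; apply: (@cg_trans _ _ _ ([:: Lz; Lz; Lz] ++ map Lold v)).
  apply: (@cg_catr _ _ (map Lold v) [:: Lz]); apply: cg_sym.
  apply: cg_trans const1_z; exact: (cg_catr [:: Lz] zz_const1).
exact: (cg_catl [:: Lz] (cg_catr (map Lold v) zz_const1)).
Qed.

(** Once [const1] is prefixed, only the images of 0 and 1 matter, and 0 is fixed, so [old_congr]
    applies. *)
Lemma z_old_congr u v : act k u (vertex1 k) = act k v (vertex1 k) ->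
  Lz :: map Lold u ~~~ Lz :: map Lold v.
Proof.
move=> uv; apply: cg_trans (z_const1_old u) _.
apply: cg_trans (cg_sym (z_const1_old v)).
apply/(cg_catl [:: Lz])/old_congr/ffunP => i.
by rewrite !(act_cat (const1 k)) act_const1 //; case: ifP => _ //; rewrite !act0.
Qed.

(** The word c also sends 1 to 0; replacing [v] by it brings in the relation z^2 c = z c. *)
Lemma z_old_zero v : act k v (vertex1 k) = ord0 ->
  Lz :: map Lold v ~~~ map Lold (const1 k ++ [:: Lc]).
Proof.
move=> v1; apply: (@cg_trans _ _ _ [:: Lz; Lold Lc]).
  by apply: (@z_old_congr v [:: Lc]); rewrite v1 act_cons act_nil tc0_1.
apply: (@cg_trans _ _ _ [:: Lz; Lz; Lold Lc]).
  exact/cg_sym/cg_rel/rel_zzc.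
by rewrite map_cat; apply: (cg_catr [:: Lold Lc] zz_const1).
Qed.

Lemma z_old_z v : act k v (vertex1 k) != ord0 ->
  Lz :: map Lold v ++ [:: Lz] ~~~ map Lold (const1 k).
Proof.
move=> v1; apply: cg_trans zz_const1.
apply: cg_trans (cg_catr [:: Lz] (z_const1_old v)) _.
apply: (cg_catl [:: Lz]); apply: old_z => i i0.
by rewrite act_cat act_const1 // (negPf i0).
Qed.

(** Induction on the word: a leading old letter joins [u], and a leading z is resolved by whether
    [u] sends 1 to 0. *)
Lemma normal_form w :
  (exists u, w ~~~ map Lold u) \/
  (exists u v, act k v (vertex1 k) != ord0 /\
     w ~~~ map Lold u ++ Lz :: map Lold v).
Proof.
elim: w => [|[x|] w [[u wu]|[u [v [v1 wuv]]]]].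
- by left; exists [::]; apply: cg_refl.
- by left; exists (x :: u); apply: (cg_catl [:: Lold x]).
- by right; exists (x :: u), v; split=> //; apply: (cg_catl [:: Lold x]).
- have [u1|u1] := eqVneq (act k u (vertex1 k)) ord0.
    left; exists (const1 k ++ [:: Lc]).
    exact: cg_trans (cg_catl [:: Lz] wu) (z_old_zero u1).
  by right; exists [::], u; split=> //; apply: (cg_catl [:: Lz]).
have {wuv} := cg_catl [:: Lz] wuv.
have [u1|u1] := eqVneq (act k u (vertex1 k)) ord0 => wuv.
  (* Here z u is old, so one z remains. *)
  right; exists (const1 k ++ [:: Lc]), v; split=> //.
  exact: cg_trans wuv (cg_catr (Lz :: map Lold v) (z_old_zero u1)).
(* Here z u z is old, so no z remains. *)
left; exists (const1 k ++ v); rewrite map_cat.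
apply: cg_trans wuv _.
by have := cg_catr (map Lold v) (z_old_z u1); rewrite /= -catA.
Qed.

Lemma wact_old_z_old u v i : wact k (map Lold u ++ Lz :: map Lold v) i =
  if act k u i == ord0 then act k v (vertex1 k) else ord0.
Proof.
rewrite wact_cat wact_cons !wact_old [wEnd_transf _ _ _]tzE.
by case: ifP => // _; rewrite act0.
Qed.

(** * Soundness, generation and completeness *)

Lemma wEnd_rel_sound u v : wEnd_rel k.+1 S u v -> wact k u = wact k v.
Proof.
have z_tz : wact k [:: Lz] = tz k.
  by apply/ffunP => i; rewrite wact_cons (wact_old k [::]) act_nil.
have xz x : (forall i, i != ord0 -> PT0_transf k x i != ord0) ->
    wact k [:: Lold x; Lz] = tz k.
  move=> x0; apply/ffunP => i; rewrite wact_cons z_tz /= !tzE.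
  have [->|/x0/negPf -> //] := eqVneq i ord0; by rewrite PT0_transf0 eqxx.
have zzE i : wact k [:: Lz; Lz] i = if i == ord0 then ord0 else vertex1 k.
  rewrite wact_cons z_tz /= !tzE; case: (i == ord0); last by rewrite eqxx.
  by rewrite (negPf (vertex1_neq0 k0)).
case=> {u v} [u v Suv|||||].
- rewrite !wact_old -!PT0_val_word_val; congr PT0_val.
  by have [_ _ <-] := hS; apply: cg_rel.
- by rewrite !xz // => i; rewrite -!val_eqE /= ?val_ta0 ?val_tb0;
    do ?case: ifP; lia.
- by rewrite !xz // => i; rewrite -!val_eqE /= ?val_te0 ?val_tb0;
    do ?case: ifP; lia.
- by rewrite z_tz xz // => i; rewrite -!val_eqE /= val_te0;
    do ?case: ifP; lia.
- have -> : word_pow [:: Lold Le; Lold Lb] (k.+1 - 3) ++ [:: Lold Le] =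
      map Lold (const1 k) by rewrite map_cat map_flatten map_nseq.
  by apply/ffunP => i; rewrite wact_old act_const1.
- apply/ffunP => i; rewrite (wact_cat [:: Lz; Lz] [:: Lold Lc]) zzE.
  rewrite (wact_cat [:: Lz] [:: Lold Lc]) z_tz.
  rewrite tzE (wact_old k [:: Lc]) !act_cons !act_nil /=.
  by case: ifP => _; rewrite tc0_1 ?(PT0_transf0 k Lc).
Qed.

Lemma wEnd_gen_inj : injective (wEnd_gen k.+1).
Proof.
have [PT0_inj _ _] := hS.
have old_neq_z x : PT0_transf k x <> tz k.
  move/ffunP/(_ ord0); rewrite PT0_transf0 tz0 => /esym/eqP.
  by rewrite (negPf (vertex1_neq0 k0)).
move=> [x|] [y|] // /(congr1 (@wEnd_val _ _)) /=.
- by move=> xy; congr Lold; apply/PT0_inj/val_inj.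
- by move/old_neq_z.
- by move/esym/old_neq_z.
Qed.

Lemma wact_onto (t : wEnd (star_edges k.+1)) : exists w, wact k w = t.
Proof.
have [t0|t0] := eqVneq (t ord0) ord0.
  by have [w wt] := act_onto t0; exists (map Lold w); rewrite wact_old.
(* [t] is factored as u z v: u sends exactly the fibre over [t ord0] to 0, z sends that fibre to 1
   and the rest to 0, and v sends 1 to [t ord0]. *)
have [|u uE] := @act_onto
    [ffun i => if t i == t ord0 then ord0 else vertex1 k].
  by rewrite ffunE eqxx.
have [|v vE] := @act_onto [ffun i => if i == ord0 then ord0 else t ord0].
  by rewrite ffunE eqxx.
exists (map Lold u ++ Lz :: map Lold v); apply/ffunP => i.
rewrite wact_old_z_old uE vE !ffunE (negPf (vertex1_neq0 k0)).
have [->|ti] := eqVneq (t i) (t ord0); first by rewrite eqxx.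
rewrite (negPf (vertex1_neq0 k0)).
(* The edge {0, i} forces [t i] to be 0, the only neighbour of the nonzero vertex [t ord0]. *)
have /weak_endoP/(_ ord0 i) := valP t; rewrite !star_edgesP eqxx (negPf t0).
rewrite [t ord0 == t i]eq_sym ti /=; have [ei|_] := eqVneq i ord0; last first.
  by move=> /(_ isT isT) /eqP.
by rewrite ei eqxx in ti.
Qed.

Lemma wact_congr w1 w2 : wact k w1 = wact k w2 -> w1 ~~~ w2.
Proof.
have sound u v : u ~~~ v -> wact k u = wact k v.
  by apply: congruence_gen_sound; apply: wEnd_rel_sound.
have wact0 u v : wact k (map Lold u ++ Lz :: map Lold v) ord0 =
    act k v (vertex1 k) by rewrite wact_old_z_old act0 eqxx.
have [[u1 e1]|[u1 [v1 [v10 e1]]]] := normal_form w1;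
  have [[u2 e2]|[u2 [v2 [v20 e2]]]] := normal_form w2;
  rewrite (sound _ _ e1) (sound _ _ e2) => w12;
  apply: cg_trans e1 _; apply: cg_trans (cg_sym e2).
- by apply: old_congr; rewrite -!wact_old.
(* Mixed forms cannot share a value: old words fix 0, while the other form moves it. *)
- by move/ffunP/(_ ord0): w12 v20; rewrite wact0 wact_old act0 => <- /eqP.
- by move/ffunP/(_ ord0): w12 v10; rewrite wact0 wact_old act0 => -> /eqP.
have v12 : act k v1 (vertex1 k) = act k v2 (vertex1 k)
  by rewrite -(wact0 u1) -(wact0 u2) w12.
apply: cg_trans (cg_catl _ (z_old_congr v12)) _.
have /cg_catr-/(_ (map Lold v2)) :
    map Lold u1 ++ [:: Lz] ~~~ map Lold u2 ++ [:: Lz].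
  (* As [v2] sends 1 to a nonzero vertex, the common value is nonzero exactly where [u1], and
     likewise [u2], gives 0. *)
  apply: old_z_congr => i; move/ffunP/(_ i): w12.
  rewrite !wact_old_z_old v12.
  by do 2!case: ifP => //; move=> _ _ w0; move: v20;
    rewrite ?w0 -?w0 eqxx.
by rewrite -!catA.
Qed.

End Relations.

Theorem theorem3p3 (n : nat) (hn : 4 <= n) (S : relations PT0_letter)
    (hS : is_presentation (PT0_gen n.-1) S) :
  is_presentation (wEnd_gen n) (wEnd_rel n S).
Proof.
case: n hn hS => // k k2 hS; split.
- exact: (wEnd_gen_inj k2 hS).
- move=> t; have [w wt] := wact_onto k2 hS t; exists w.
  by apply: val_inj; rewrite /= wEnd_val_word_val.
move=> w1 w2; split=> [|w12].
  move=> w12; apply: val_inj; rewrite /= !wEnd_val_word_val.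
  exact: congruence_gen_sound (wEnd_rel_sound k2 hS) _ _ w12.
by apply: (wact_congr k2 hS); rewrite -!wEnd_val_word_val w12.
Qed.
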